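(* For every integer $n\ge0$, $$P_n(x)=(2x)^n+(1-x)\sum_{j=0}^{n-1}\mathcal{B}(n-j-1,0)\,P_j(x)\,x^{n-j-1}.$$
   Context: For $0\le k\le n$ let $\mathcal{B}(n,k)=\binom{n}{\lfloor (n-k)/2\rfloor}$, so $\mathcal{B}(m,0)=\binom{m}{\lfloor m/2\rfloor}$, and let $P_n(x)=\sum_{k=0}^n\mathcal{B}(n,k)x^{n-k}$. *)

(* Defs.v *)
From mathcomp Require Import all_boot all_order all_algebra.

Set Implicit Arguments.
Unset Strict Implicit.
Unset Printing Implicit Defensive.

Import GRing.Theory.
Local Open Scope ring_scope.

(* Used only for k <= n, where the truncated subtraction is exact. *)
Definition calB (n k : nat) : nat := 'C(n, (n - k)./2).

Definition P (n : nat) : {poly int} :=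
  \sum_(0 <= k < n.+1) (calB n k)%:R *: 'X^(n - k).

(* Main.v *)
Require Import Defs.
From mathcomp Require Import all_boot all_order all_algebra.
From mathcomp Require Import zify ring.

(** Write b_n for B(n,0) and S_n for the sum on the right-hand side. Pascal's
    rule gives P_{n+1} = (1 + x^2) P_n + b_n x^{n+1} (1 - x), and hence
    S_{n+1} = b_n x^n + (1 + x^2) S_n + (1 - x) c_n x^n with
    c_n = sum_j b_{n-1-j} b_j. As deg S_n < n and c_n is its coefficient of
    x^{n-1}, comparing the coefficients of x^n in the identity for n gives
    c_n = 2^n - b_n, which is what the identity for n + 1 requires. *)

Set Implicit Arguments.
Unset Strict Implicit.
Unset Printing Implicit Defensive.

Import GRing.Theory.
Local Open Scope ring_scope.

(** Substituting [i = n - k] reverses the sum, so that coefficients can be read off directly. *)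
Lemma P_poly (n : nat) : P n = \poly_(i < n.+1) ('C(n, i./2))%:R.
Proof.
rewrite /P big_mkord poly_def (reindex_inj rev_ord_inj) /=.
by apply: eq_bigr => i _; rewrite subSS /calB subKn // -ltnS.
Qed.

Lemma coef_P (n i : nat) :
  (P n)`_i = if (i <= n)%N then ('C(n, i./2))%:R else 0.
Proof. by rewrite P_poly coef_poly ltnS. Qed.

Lemma coef_P_diag (n : nat) : (P n)`_n = (calB n 0)%:R.
Proof. by rewrite coef_P leqnn /calB subn0. Qed.

(** In each degree [i >= 2] this is Pascal's rule, since [i./2] drops by one when [i] drops by two.
    The last term repairs the truncation of the sum in degrees [n.+1] and [n.+2]. *)
Lemma poly_half_binomial_rec (R : comNzRingType) (n : nat) :
  \poly_(i < n.+2) ('C(n.+1, i./2))%:R =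
  (1 + 'X^2) * \poly_(i < n.+1) ('C(n, i./2))%:R
    + (1 - 'X) * (('C(n, n./2))%:R *: 'X^(n.+1)) :> {poly R}.
Proof.
set p := \poly_(i < n.+1) _; set b : R := ('C(n, n./2))%:R.
have -> : (1 + 'X^2) * p + (1 - 'X) * (b *: 'X^(n.+1)) =
    p + p * 'X^2 + (b *: 'X^(n.+1) - b *: 'X^(n.+2)).
  by rewrite -!mul_polyC (exprS _ n.+1); ring.
apply/polyP => i; rewrite {}/b.
rewrite !(coefD, coefN, coefZ, coefXn, coefMXn, coef_poly).
case: i => [|[|m]] /=.
- by rewrite !bin0; ring.
- by rewrite !bin0; case: n @p => [|n] _ /=; rewrite ?bin0 //=; ring.
rewrite !subSS subn0 !eqSS !ltnS.
have [ltmn|gtmn|<-] := ltngtP m.+1 n.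
- by rewrite (ltnW (ltnW ltmn)) (ltn_eqF (ltnW ltmn)) binS natrD; ring.
(* At [m = n], in degree [n.+2], the top term of [p * 'X^2] cancels against [- b]; above that
   everything vanishes. *)
- by have [ltnm|ltmn|->] := ltngtP m n; [lia
    | rewrite subrr !addr0 | rewrite mulr0 mulr1; ring].
(* In degree [n.+1], with [n = m.+1], [p] has no coefficient; by the symmetry of binomials [b] is
   exactly the missing Pascal summand. *)
have -> : 'C(m.+1, m.+1./2) = 'C(m.+1, m./2.+1).
  by rewrite -bin_sub; [congr 'C(_, _) | ]; lia.
by rewrite leqnSn (ltn_eqF (ltnSn m)) mulr1 mulr0 binS natrD; ring.
Qed.

Lemma P_rec (n : nat) :
  P n.+1 = (1 + 'X^2) * P n + (1 - 'X) * ((calB n 0)%:R *: 'X^(n.+1)).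
Proof. by rewrite !P_poly poly_half_binomial_rec /calB subn0. Qed.

(** Every summand of the inner sum has degree [n - 1], so only the leading coefficient of each [P j]
    survives. *)
Lemma coef_conv_diag (n : nat) :
  ('X * \sum_(0 <= j < n)
           (calB (n - j - 1) 0)%:R *: (P j * 'X^(n - j - 1)))`_n
  = \sum_(0 <= j < n) (calB (n - j - 1) 0)%:R * (calB j 0)%:R :> int.
Proof.
rewrite mulr_sumr coef_sum; apply: eq_big_nat => j /andP[_ ltjn].
rewrite coefXM coefZ coefMXn.
have -> : (n == 0)%N = false by lia.
have -> : (n.-1 < n - j - 1)%N = false by lia.
by have -> : (n.-1 - (n - j - 1))%N = j; [lia | rewrite coef_P_diag].
Qed.

Lemma coef_conv_over (n : nat) :
  (\sum_(0 <= j < n)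
           (calB (n - j - 1) 0)%:R *: (P j * 'X^(n - j - 1)))`_n = 0 :> int.
Proof.
rewrite coef_sum big_nat; apply: big1 => j /andP[_ ltjn].
rewrite coefZ coefMXn coef_P.
have -> : (n < n - j - 1)%N = false by lia.
have -> : (n - (n - j - 1) <= j)%N = false by lia.
by rewrite mulr0.
Qed.

Theorem theorem3p5 (n : nat) :
  P n = (2%:R *: 'X) ^+ n
        + (1 - 'X) * \sum_(0 <= j < n)
            (calB (n - j - 1) 0)%:R *: (P j * 'X^(n - j - 1)).
Proof.
elim: n => [|n IHn].
  by rewrite P_poly big_nil mulr0 addr0 expr0 poly_def big_ord1 scale1r.
have conv : \sum_(0 <= j < n) (calB (n - j - 1) 0)%:R * (calB j 0)%:R
    = 2 ^+ n - (calB n 0)%:R :> int.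
  have /(congr1 (fun p : {poly int} => p`_n)) := IHn.
  rewrite mulrBl mul1r exprZn !coefD coefN coef_conv_diag coef_conv_over.
  rewrite coefZ coefXn eqxx coef_P_diag mulr1 sub0r => ->.
  by rewrite opprD opprK addrA subrr add0r.
set S := \sum_(0 <= j < n) _ in IHn.
have -> : \sum_(0 <= j < n.+1)
      (calB (n.+1 - j - 1) 0)%:R *: (P j * 'X^(n.+1 - j - 1))
    = (calB n 0)%:R *: 'X^n + (1 + 'X^2) * S
      + (1 - 'X) * ((2 ^+ n - (calB n 0)%:R) *: 'X^n).
  rewrite big_nat_recl // subn0 subn1 /=.
  have -> : P 0 = 1 by rewrite P_poly poly_def big_ord1 scale1r.
  (* Expanding [2 ^+ n - calB n 0] back into the convolution makes both sides sums over [j < n],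
     which then agree term by term through [P_rec]. *)
  rewrite mul1r -addrA -conv scaler_suml !mulr_sumr -big_split /=.
  congr (_ + _); apply: eq_big_nat => j /andP[_ ltjn].
  rewrite !subSS P_rec -!mul_polyC polyCM.
  have -> : 'X^n = 'X^(n - j - 1) * 'X^(j.+1) :> {poly int}.
    by rewrite -exprD; congr (_ ^+ _); lia.
  by ring.
rewrite P_rec IHn !exprZn -!mul_polyC polyCB (exprS 2%:R n) (exprS 'X n).
rewrite polyCM polyC_natr.
by ring.
Qed.
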